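(* Let $G$ be a graph on the vertex set $\{1,\dots,n\}$ with adjacency matrix $\Gamma$ over $\mathbb{F}_2$, and let $L_e(G)$ be the set of all graphs (on the vertex set $\{1,\dots,n\}$) that are edge-locally equivalent to $G$. Then $$|L_e(G)|=\frac{|\Delta_e(G)|}{|\Sigma_e(G)|},$$ where moreover $$|\Delta_e(G)|=|\{\omega\subseteq\{1,\dots,n\} \mid \Gamma[\omega]\mbox{ is nonsingular}\}|,\qquad \Sigma_e(G)=\{x\in\mathbb{F}_2^n\mid (\Gamma+I)\hat{x}(\Gamma+I)=0\}.$$
   Context: All matrices are over $\mathbb{F}_2$. Graphs are finite, undirected and simple with vertex set $V=\{1,\dots,n\}$; an adjacency matrix is a symmetric matrix over $\mathbb{F}_2$ with zero diagonal. For $x\in\mathbb{F}_2^n$, $\hat{x}$ is the diagonal $n\times n$ matrix with the entries of $x$ on the diagonal. For $\omega\subseteq\{1,\dots,n\}$, $\Gamma[\omega]=(\Gamma_{ij})_{i,j\in\omega}$ is the principal submatrix; the empty matrix counts as nonsingular. For a diagonal matrix $A$, let $H^A(\Gamma)=((A+I)\Gamma+A)(A\Gamma+A+I)^{-1}$ whenever $A\Gamma+A+I$ is nonsingular, and let $\Delta(H^A)$ be the set of $n\times n$ adjacency matrices $\Gamma$ such that $A\Gamma+A+I$ is nonsingular and $H^A(\Gamma)$ has zero diagonal. Define $\Delta_e(G)=\{x\in\mathbb{F}_2^n\mid \Gamma\in\Delta(H^{\hat{x}})\}$ and $\Sigma_e(G)=\{x\in\mathbb{F}_2^n\mid \Gamma\in\Delta(H^{\hat{x}}),\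 H^{\hat{x}}(\Gamma)=\Gamma\}$. Local complementation: for a vertex $i$, $G*i$ is the graph on $V$ obtained from $G$ by replacing the subgraph induced on the neighborhood $N(i)$ by its complement and leaving the rest unchanged. For an edge $e=\{i,j\}$ of $G$, the edge-local complement is $G*e=((G*i)*j)*i=((G*j)*i)*j$. Two graphs $G,G'$ on $V$ are edge-locally equivalent if there is a finite (possibly empty) sequence $e_1,\dots,e_N$ of 2-element subsets of $V$ such that $e_1$ is an edge of $G$, $e_\alpha$ is an edge of $((G*e_1)*\dots)*e_{\alpha-1}$ for $\alpha=2,\dots,N$, and $((G*e_1)*\dots)*e_N=G'$. *)

(* Defs.v *)
From HB Require Import structures.
From mathcomp Require Import all_boot all_order all_algebra.

Set Implicit Arguments.
Unset Strict Implicit.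
Unset Printing Implicit Defensive.

Import GRing.Theory.
Local Open Scope ring_scope.

(* Finite simple graphs on the vertex set 'I_n: a set of 2-element subsets. *)
Record sgraph (n : nat) := SGraph {
  edges : {set {set 'I_n}};
  edges_card2 : [forall e in edges, #|e| == 2%N]
}.

HB.instance Definition _ n := [isSub for @edges n].
HB.instance Definition _ n := [Finite of sgraph n by <:].

(* Since [set i; i] has one element, adjacent G i i = false. *)
Definition adjacent n (G : sgraph n) (i j : 'I_n) : bool :=
  [set i; j] \in edges G.

Definition neighbors n (G : sgraph n) (i : 'I_n) : {set 'I_n} :=
  [set j | adjacent G i j].

Definition adjmx n (G : sgraph n) : 'M['F_2]_n :=
  \matrix_(i, j) (adjacent G i j)%:R.

(* Local complement G * i: toggle exactly the pairs inside the neighborhood. *)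
Definition lc_edges n (G : sgraph n) (i : 'I_n) : {set {set 'I_n}} :=
  [set e : {set 'I_n} |
    (#|e| == 2%N) && ((e \in edges G) (+) (e \subset neighbors G i))].

Lemma lc_edges_card2 n (G : sgraph n) (i : 'I_n) :
  [forall e in lc_edges G i, #|e| == 2%N].
Proof. by apply/forall_inP => e; rewrite inE => /andP[]. Qed.

Definition lc n (G : sgraph n) (i : 'I_n) : sgraph n :=
  SGraph (lc_edges_card2 G i).

(* Edge-local complement G * {i, j}; only used when {i, j} is an edge of G,
   in which case it does not depend on the order of i and j (elcC below). *)
Definition elc n (G : sgraph n) (i j : 'I_n) : sgraph n := lc (lc (lc G i) j) i.

Definition elc_step n : rel (sgraph n) := fun G G' =>
  [exists i, exists j, adjacent G i j && (G' == elc G i j)].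

(* connect is the reflexive transitive closure: a finite, possibly empty,
   sequence of edge-local complementations leads from G to G'. *)
Definition edge_locally_equiv n : rel (sgraph n) := connect (@elc_step n).

Definition Le n (G : sgraph n) : {set sgraph n} :=
  [set G' | edge_locally_equiv G G'].

Definition adjacency_matrix n (Gam : 'M['F_2]_n) : bool :=
  (Gam^T == Gam) && [forall i, Gam i i == 0].

(* Meaningful only when A *m Gam + A + 1%:M is nonsingular. *)
Definition HA n (A Gam : 'M['F_2]_n) : 'M['F_2]_n :=
  ((A + 1%:M) *m Gam + A) *m invmx (A *m Gam + A + 1%:M).

Definition DeltaH n (A : 'M['F_2]_n) : {set 'M['F_2]_n} :=
  [set Gam | [&& adjacency_matrix Gam, A *m Gam + A + 1%:M \in unitmx
               & [forall i, HA A Gam i i == 0]]].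

Definition Delta_e n (G : sgraph n) : {set 'rV['F_2]_n} :=
  [set x | adjmx G \in DeltaH (diag_mx x)].

Definition Sigma_e n (G : sgraph n) : {set 'rV['F_2]_n} :=
  [set x | (adjmx G \in DeltaH (diag_mx x))
           && (HA (diag_mx x) (adjmx G) == adjmx G)].

(* For w = set0 this is the 0 x 0 matrix, which belongs to unitmx. *)
Definition principal_submx n (Gam : 'M['F_2]_n) (w : {set 'I_n}) :
    'M['F_2]_#|w| :=
  mxsub (@enum_val _ (mem w)) (@enum_val _ (mem w)) Gam.

Lemma adjacentC n (G : sgraph n) i j : adjacent G i j = adjacent G j i.
Proof. by rewrite /adjacent setUC. Qed.

Lemma adjacentxx n (G : sgraph n) i : adjacent G i i = false.
Proof.
apply/negP => /(forall_inP (edges_card2 G)).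
by rewrite setUid cards1.
Qed.

Lemma adjacent_lc n (G : sgraph n) k i j :
  adjacent (lc G k) i j =
  (i != j) && (adjacent G i j (+) (adjacent G k i && adjacent G k j)).
Proof.
rewrite {1}/adjacent inE cards2 subUset !sub1set !inE.
by case: (i != j).
Qed.

Lemma sgraphP n (G G' : sgraph n) :
  (forall i j, adjacent G i j = adjacent G' i j) -> G = G'.
Proof.
move=> eqG; apply/val_inj/setP => e /=.
have [/cards2P[i [j [_ ->]]]|nc] := boolP (#|e| == 2%N); first exact: eqG.
by apply/idP/idP => /(forall_inP (edges_card2 _)); rewrite (negPf nc).
Qed.

Lemma elcC n (G : sgraph n) i j : adjacent G i j -> elc G i j = elc G j i.
Proof.
move=> Gij; have nij : i != j.
  by apply: contraTneq Gij => ->; rewrite adjacentxx.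
have Gji : adjacent G j i by rewrite adjacentC.
have nji : j != i by rewrite eq_sym.
apply: sgraphP => a b; rewrite /elc !adjacent_lc.
rewrite !adjacentxx ?eqxx nij nji Gij Gji /= ?addbF.
rewrite (adjacentC G j a) (adjacentC G i a) (adjacentC G j b) (adjacentC G i b).
have [->|nab] := eqVneq a b => //=.
have nba : b != a by rewrite eq_sym.
have [eia|nia] := eqVneq i a; last have [eja|nja] := eqVneq j a.
all: have [eib|nib] := eqVneq i b; last have [ejb|njb] := eqVneq j b.
all: subst; try (by rewrite eqxx in nab); try (by rewrite eqxx in nij).
all: rewrite ?adjacentxx ?eqxx ?Gij ?Gji ?nij ?nji ?nab ?nba ?nia ?nja ?nib ?njb //=.
all: repeat match goal with |- context [adjacent ?G ?u ?v] =>
  case: (adjacent G u v) => //= end.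
Qed.

(* Main.v *)
(* The map [H^x] is the principal pivot transform on the support of [x], so
   [H^y (H^x M) = H^(x + y) M] whenever both sides make sense. An edge-local
   complementation at [{i, j}] is the pivot with [x = e_i + e_j], and a pivot of
   an adjacency matrix with nonempty support always contains an edge, so every
   pivot is a composition of edge pivots. Hence the class of [G] is the image of
   [Delta_e G] under [x |-> H^x], whose fibres are the cosets of [Sigma_e G]. *)

Require Import Defs.
From HB Require Import structures.
From mathcomp Require Import all_boot all_order all_algebra.

Set Implicit Arguments.
Unset Strict Implicit.
Unset Printing Implicit Defensive.

Import GRing.Theory.
Local Open Scope ring_scope.

Lemma F2_natb (a : 'F_2) : {b : bool | a = b%:R}.
Proof. by exists (a != 0); case: a => [[|[|[]]] // lt_a]; apply: val_inj. Qed.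

Lemma F2_addrr (V : lmodType 'F_2) (v : V) : v + v = 0.
Proof.
by rewrite -mulr2n -scaler_nat (_ : 2%:R = 0) ?scale0r //; apply: val_inj.
Qed.

Lemma F2_addr_eq0 (V : lmodType 'F_2) (u v : V) : (u + v == 0) = (u == v).
Proof. by rewrite -[in RHS](inj_eq (addIr v)) F2_addrr. Qed.

(** If [W] inverts [1 + Y X], then [1 - X W Y] inverts [1 + X Y], because
    [(1 + X Y) X W = X (1 + Y X) W = X]. This lets invertibility pass between matrices of different
    sizes. *)
Lemma unitmx_1Dmul (R : comUnitRingType) (m n : nat)
    (U : 'M[R]_(m, n)) (V : 'M[R]_(n, m)) :
  (1%:M + U *m V \in unitmx) = (1%:M + V *m U \in unitmx).
Proof.
have imp p q (X : 'M[R]_(p, q)) (Y : 'M[R]_(q, p)) :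
  1%:M + Y *m X \in unitmx -> 1%:M + X *m Y \in unitmx.
  move=> uYX; set W := invmx (1%:M + Y *m X).
  apply: (@proj1 _ (1%:M - X *m W *m Y \in unitmx)); apply: mulmx1_unit.
  have XW : (1%:M + X *m Y) *m X *m W = X.
    by rewrite mulmxDl mul1mx -mulmxA -{1}[X]mulmx1 -mulmxDr mulmxK.
  by rewrite mulmxBr mulmx1 !mulmxA XW -addrA subrr addr0.
by apply/idP/idP; apply: imp.
Qed.

(** * The principal pivot transform and its composition law *)

Section Pivot.
Variable n : nat.
Implicit Types (x y : 'rV['F_2]_n) (M : 'M['F_2]_n) (G : sgraph n).

(** Row [i] of [pivot_den] is that of [M] if [x 0 i = 1] and that of the identity otherwise; in
    [pivot_num] the two choices are swapped. *)
Definition pivot_den x M := diag_mx x *m M + diag_mx x + 1%:M.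
Definition pivot_num x M := (diag_mx x + 1%:M) *m M + diag_mx x.

Lemma pivot_denE x M i j :
  pivot_den x M i j = x 0 i * M i j + (x 0 i + 1) * (i == j)%:R.
Proof.
rewrite /pivot_den mul_diag_mx !mxE mulrDl mul1r addrA.
by case: eqP; rewrite ?mulr1 ?mulr0 ?mulr1n ?mulr0n.
Qed.

Lemma pivot_numE x M i j :
  pivot_num x M i j = (x 0 i + 1) * M i j + x 0 i * (i == j)%:R.
Proof.
rewrite /pivot_num mulmxDl mul1mx mul_diag_mx !mxE mulrDl mul1r.
by case: eqP; rewrite ?mulr1 ?mulr0 ?mulr1n ?mulr0n.
Qed.

Lemma pivot_den0 M : pivot_den 0 M = 1%:M.
Proof. by rewrite /pivot_den raddf0 mul0mx !add0r. Qed.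

Lemma pivot_num0 M : pivot_num 0 M = M.
Proof. by rewrite /pivot_num raddf0 add0r mul1mx addr0. Qed.

Lemma HA0 M : HA (diag_mx 0) M = M.
Proof.
rewrite /HA -/(pivot_num _ _) -/(pivot_den _ _) pivot_num0 pivot_den0.
by rewrite invmx1 mulmx1.
Qed.

Lemma HA_den x M : pivot_den x M \in unitmx ->
  HA (diag_mx x) M *m pivot_den x M = pivot_num x M.
Proof. by move=> uD; rewrite /HA -/(pivot_den x M) mulmxKV. Qed.

Lemma HA_eq x M M' : pivot_den x M \in unitmx ->
  M' *m pivot_den x M = pivot_num x M -> M' = HA (diag_mx x) M.
Proof. by move=> uD eqN; rewrite /HA -/(pivot_num x M) -eqN mulmxK. Qed.

(* Pivoting exchanges the coordinates in the support of [x] between the two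
   halves of the Lagrangian subspace {(M u, u)}, and such exchanges compose. *)
Lemma pivot_denD x y M M' : M' *m pivot_den x M = pivot_num x M ->
  pivot_den y M' *m pivot_den x M = pivot_den (x + y) M.
Proof.
move=> eqM'; apply/matrixP => i j; rewrite [RHS]pivot_denE {1}/pivot_den.
rewrite !mulmxDl mul1mx -mulmxA eqM' !mul_diag_mx.
have := pivot_denE x M i j; have := pivot_numE x M i j.
move: (pivot_den x M) (pivot_num x M) => D N eqN eqD; rewrite !mxE eqN eqD.
(* Diagonal factors act row by row, so only three bits and the test [i == j] remain: sixteen
   cases. *)
have [b ->] := F2_natb (x 0 i); have [c ->] := F2_natb (y 0 i).
have [d ->] := F2_natb (M i j).
by apply: val_inj; case: (i == j) b c d => [] [] [] [].
Qed.

Lemma pivot_numD x y M M' : M' *m pivot_den x M = pivot_num x M ->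
  pivot_num y M' *m pivot_den x M = pivot_num (x + y) M.
Proof.
move=> eqM'; apply/matrixP => i j; rewrite [RHS]pivot_numE {1}/pivot_num.
rewrite !mulmxDl mul1mx -mulmxA eqM' !mul_diag_mx.
have := pivot_denE x M i j; have := pivot_numE x M i j.
move: (pivot_den x M) (pivot_num x M) => D N eqN eqD; rewrite !mxE eqN eqD.
have [b ->] := F2_natb (x 0 i); have [c ->] := F2_natb (y 0 i).
have [d ->] := F2_natb (M i j).
by apply: val_inj; case: (i == j) b c d => [] [] [] [].
Qed.

Lemma HA_comp_unit x y M : pivot_den x M \in unitmx ->
  (pivot_den y (HA (diag_mx x) M) \in unitmx)
  = (pivot_den (x + y) M \in unitmx).
Proof.
by move=> uD; rewrite -(pivot_denD y (HA_den uD)) unitmx_mul uD andbT.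
Qed.

Lemma HA_comp x y M : pivot_den x M \in unitmx ->
  pivot_den (x + y) M \in unitmx ->
  HA (diag_mx y) (HA (diag_mx x) M) = HA (diag_mx (x + y)) M.
Proof.
move=> uD uDxy; apply: HA_eq => //; have eqD := HA_den uD.
have uD' : pivot_den y (HA (diag_mx x) M) \in unitmx by rewrite HA_comp_unit.
by rewrite -(pivot_denD y eqD) mulmxA (HA_den uD') (pivot_numD y eqD).
Qed.

(** In characteristic 2 the right-hand product equals [M *m pivot_den x M + pivot_num x M]. Its
    vanishing is the fixed-point equation cleared of the inverse. *)
Lemma HA_fixP x M :
  (pivot_den x M \in unitmx) && (HA (diag_mx x) M == M)
  = ((M + 1%:M) *m diag_mx x *m (M + 1%:M) == 0).
Proof.
have denE : pivot_den x M = 1%:M + diag_mx x *m (M + 1%:M).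
  by rewrite /pivot_den mulmxDr mulmx1 addrC.
have fixE : M *m pivot_den x M + pivot_num x M
    = (M + 1%:M) *m diag_mx x *m (M + 1%:M).
  rewrite denE /pivot_num !(mulmxDr, mulmxDl, mul1mx, mulmx1) -!mulmxA.
  rewrite [diag_mx x *m M + M]addrC -[M + _ + diag_mx x]addrA addrACA F2_addrr.
  by rewrite add0r addrACA.
rewrite -fixE F2_addr_eq0; apply/andP/eqP => [[uD /eqP fixM]|eqM].
  by rewrite -{1}fixM HA_den.
(* Pivoting twice by [x] is pivoting by [x + x = 0], so the cleared equation makes [pivot_den x M]
   its own inverse. *)
have uD : pivot_den x M \in unitmx.
  have := pivot_denD x eqM; rewrite F2_addrr pivot_den0.
  by case/mulmx1_unit.
by split=> //; rewrite eq_sym; apply/eqP/HA_eq.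
Qed.

(** * Denominators and principal submatrices *)

Definition support_set x : {set 'I_n} := [set i | x 0 i != 0].

Lemma support_set_bij : bijective support_set.
Proof.
exists (fun w : {set 'I_n} => \row_i (i \in w)%:R) => [x|w].
  apply/rowP => i; rewrite !mxE inE.
  by case: (F2_natb (x 0 i)) => [[] ->]; rewrite ?oner_eq0 ?eqxx.
by apply/setP => i; rewrite inE mxE; case: (i \in w); rewrite ?oner_eq0 ?eqxx.
Qed.

(** Let [E] consist of the identity columns indexed by the support, so [E E^T] is [diag_mx x] and
    [E^T E = 1]. The denominator is [1 + E (E^T (M + 1))]; swapping the factors by [unitmx_1Dmul]
    gives [1 + E^T M E + 1], which is the principal submatrix. *)
Lemma pivot_den_unit x M :
  (pivot_den x M \in unitmx) = (principal_submx M (support_set x) \in unitmx).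
Proof.
set w := support_set x; set f := @enum_val _ (mem w).
pose E : 'M['F_2]_(n, #|w|) := colsub f 1%:M.
have EET : E *m E^T = diag_mx x.
  apply/matrixP => i j; rewrite !mxE.
  under eq_bigr do rewrite !mxE -natrM mulnb.
  have [wi|wi] := boolP (i \in w).
    rewrite (bigD1 (enum_rank_in wi i)) //= /f enum_rankK_in // eqxx big1.
      move: wi; rewrite inE; case: (F2_natb (x 0 i)) => [[] ->] //.
      by move=> _; rewrite addr0 eq_sym; case: eqP.
    move=> k /eqP nk; case: eqP => //= ik; case: nk.
    by apply: enum_val_inj; rewrite enum_rankK_in // ik.
  rewrite big1 => [|k _].
    move: wi; rewrite inE negbK => /eqP->.
    by rewrite mul0rn.
  by case: eqP => // ik; move: wi; rewrite ik enum_valP.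
have ETE : E^T *m E = 1%:M.
  apply/matrixP => k l; rewrite !mxE (bigD1 (f k)) //= !mxE eqxx mul1r.
  rewrite big1 ?addr0 ?(inj_eq enum_val_inj) // => i ni.
  by rewrite !mxE (negPf ni) mul0r.
have subE : principal_submx M w = E^T *m M *m E.
  have -> : E^T = rowsub f 1%:M by apply/matrixP => k l; rewrite !mxE eq_sym.
  rewrite mul_rowsub_mx mul1mx mulmx_colsub mulmx1.
  by apply/matrixP => k l; rewrite !mxE.
have -> : pivot_den x M = 1%:M + E *m (E^T *m (M + 1%:M)).
  by rewrite mulmxA EET mulmxDr mulmx1 addrC.
rewrite unitmx_1Dmul subE mulmxDr mulmx1 mulmxDl ETE addrCA F2_addrr.
by rewrite addr0.
Qed.

(** * Edge-local complementation as pivoting *)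

Lemma adjmx_inj : injective (@adjmx n).
Proof.
move=> G G' /matrixP eqG; apply: sgraphP => i j; move: (eqG i j).
by rewrite !mxE; case: adjacent; case: adjacent.
Qed.

Lemma adjmx_adjacency G : adjacency_matrix (adjmx G).
Proof.
apply/andP; split; last by apply/forallP=> i; rewrite mxE adjacentxx.
by apply/eqP/matrixP => i j; rewrite !mxE adjacentC.
Qed.

Definition pair_row (i j : 'I_n) : 'rV['F_2]_n := delta_mx 0 i + delta_mx 0 j.

(** Clearing the inverse turns the claim into an entrywise identity, settled by the coincidences
    among [a], [b], [i], [j] and the remaining adjacency bits. *)
Lemma elc_pivot G i j : adjacent G i j ->
  adjmx (elc G i j) *m pivot_den (pair_row i j) (adjmx G)
  = pivot_num (pair_row i j) (adjmx G).
Proof.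
move=> Gij; have nij : i != j.
  by apply: contraTneq Gij => ->; rewrite adjacentxx.
have Gji : adjacent G j i by rewrite adjacentC.
have nji : j != i by rewrite eq_sym.
apply/matrixP => a b.
(* Rows of the denominator other than [i] and [j] are unit vectors, so the sum collapses to three
   terms. *)
have -> : (adjmx (elc G i j) *m pivot_den (pair_row i j) (adjmx G)) a b
  = (adjacent (elc G i j) a i && adjacent G i b)%:R
    + (adjacent (elc G i j) a j && adjacent G j b)%:R
    + ((b != i) && (b != j) && adjacent (elc G i j) a b)%:R.
  rewrite mxE (bigD1 i) //= (bigD1 j) //= addrA !pivot_denE !mxE !eqxx.
  rewrite (negPf nij) (negPf nji) /=.
  rewrite !(addr0, add0r) !mul1r (_ : 1%:R + 1 = 0) ?mul0r; last exact: val_inj.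
  rewrite !addr0 -!natrM !mulnb; congr (_ + _).
  rewrite (eq_bigr (fun k => (adjacent (elc G i j) a k && (k == b))%:R)).
    have [bij|] := boolP ((b != i) && (b != j)).
      rewrite (bigD1 b) //= eqxx andbT big1 ?addr0 // => k /andP[_ /negPf->].
      by rewrite andbF.
    rewrite negb_and !negbK => bij; rewrite big1 // => k /andP[ki kj].
    by case/orP: bij => /eqP->; rewrite ?(negPf ki) ?(negPf kj) andbF.
  move=> k /andP[/negPf ki /negPf kj]; rewrite pivot_denE !mxE ki kj /=.
  by rewrite !add0r mul0r add0r mul1r -natrM mulnb.
rewrite pivot_numE !mxE eqxx /= /elc !adjacent_lc.
rewrite !adjacentxx ?eqxx nij nji Gij Gji /= ?addbF.
rewrite (adjacentC G j a) (adjacentC G i a) (adjacentC G j b) (adjacentC G i b).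
rewrite ![_ == i]eq_sym ![_ == j]eq_sym.
have [<-|nab] := eqVneq a b; have [eia|nia] := eqVneq i a.
all: try have [eja|nja] := eqVneq j a.
all: try have [eib|nib] := eqVneq i b; try have [ejb|njb] := eqVneq j b.
all: subst; try (by rewrite eqxx in nab); try (by rewrite eqxx in nij).
all: try (have nba : b != a by rewrite eq_sym).
all: rewrite ?adjacentxx ?eqxx ?Gij ?Gji ?nij ?nji ?nab ?nba ?nia ?nja ?nib ?njb //=.
all: try rewrite (adjacentC G b a).
all: repeat match goal with |- context [adjacent ?G ?u ?v] =>
  case: (adjacent G u v) end.
all: by apply: val_inj.
Qed.

Lemma elc_HA G i j : adjacent G i j ->
  pivot_den (pair_row i j) (adjmx G) \in unitmx /\
  adjmx (elc G i j) = HA (diag_mx (pair_row i j)) (adjmx G).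
Proof.
move=> /elc_pivot eqN.
have uD : pivot_den (pair_row i j) (adjmx G) \in unitmx.
  have := pivot_denD (pair_row i j) eqN; rewrite F2_addrr pivot_den0.
  by case/mulmx1_unit.
by split=> //; apply: HA_eq.
Qed.

(* If no such [j] existed, the row [e_i + M_i] would lie in the left kernel of
   [pivot_den x M]. *)
Lemma pivot_edge x M i : pivot_den x M \in unitmx -> M i i = 0 -> x 0 i != 0 ->
  exists2 j, x 0 j != 0 & M i j != 0.
Proof.
move=> uD Mii xi; apply/exists_inP; apply: contraTT isT => noj.
have Mx0 : row i M *m diag_mx x = 0.
  apply/rowP => j; rewrite mul_mx_diag !mxE.
  have [->|xj] := eqVneq (x 0 j) 0; first by rewrite mulr0.
  have [->|Mij] := eqVneq (M i j) 0; first by rewrite mul0r.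
  by case/exists_inP: noj; exists j.
have rowD : row i (pivot_den x M) = row i M.
  apply/rowP => j; rewrite [LHS]mxE [RHS]mxE pivot_denE.
  case: (F2_natb (x 0 i)) xi => [[] ->] // _.
  by rewrite mul1r (_ : true%:R + 1 = 0) ?mul0r ?addr0 //; apply: val_inj.
have : (delta_mx 0 i + row i M) *m pivot_den x M = 0.
  rewrite mulmxDl -rowE rowD /pivot_den !mulmxDr mulmx1 mulmxA Mx0 mul0mx.
  by rewrite !add0r F2_addrr.
move/(congr1 (mulmx^~ (invmx (pivot_den x M)))); rewrite mulmxK // mul0mx.
(* The kernel vector is nonzero: its entry [i] is [1 + M i i = 1]. *)
by move/rowP/(_ i); rewrite !mxE !eqxx Mii.
Qed.

(** Induction on the size of the support: [pivot_edge] finds an edge inside it, and pivoting there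
    first leaves a pivot on the support without both endpoints. *)
Lemma pivot_reachable G x : pivot_den x (adjmx G) \in unitmx ->
  exists2 G', G' \in Le G & adjmx G' = HA (diag_mx x) (adjmx G).
Proof.
have [m] := ubnP #|support_set x|; elim: m => // m IHm in G x *.
rewrite ltnS => lexm uD; have [x0|] := eqVneq (support_set x) set0.
  have -> : x = 0.
    apply/rowP => i; move/setP/(_ i): x0; rewrite !inE mxE.
    by move/negbFE/eqP.
  by exists G; rewrite ?HA0 // inE /edge_locally_equiv connect0.
case/set0Pn => i; rewrite inE => xi.
have [|j xj] := pivot_edge uD _ xi; first by rewrite mxE adjacentxx.
rewrite mxE; have [Gij _|] := boolP (adjacent G i j); last by rewrite eqxx.
have nij : i != j by apply: contraTneq Gij => ->; rewrite adjacentxx.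
have [uDij eqG'] := elc_HA Gij; set y := pair_row i j in uDij eqG'.
have xE : y + (y + x) = x by rewrite addrA F2_addrr add0r.
have uD' : pivot_den (y + x) (adjmx (elc G i j)) \in unitmx.
  by rewrite eqG' HA_comp_unit ?xE.
have [|G'' ] := IHm (elc G i j) (y + x) _ uD'.
  apply: leq_trans lexm; apply: proper_card; apply/properP; split.
    (* Adding [y] changes only the coordinates [i] and [j], both already in the support of [x]. *)
    apply/subsetP => k; rewrite !inE !mxE !eqxx /=.
    have [->|_] := eqVneq k i; first by [].
    have [->|_] := eqVneq k j; first by [].
    by rewrite !add0r.
  exists i; rewrite !inE // negbK !mxE !eqxx (negPf nij) addr0.
  by case: (F2_natb (x 0 i)) xi => [[] ->].
rewrite inE eqG' HA_comp ?xE // => LeG'' eqG''; exists G'' => //.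
rewrite inE; apply: connect_trans LeG''; apply: connect1.
by apply/existsP; exists i; apply/existsP; exists j; rewrite Gij eqxx.
Qed.

(** Peeling off the last step of the path keeps every pivot based at [G]; the composition law then
    adds the vector of the last edge. *)
Lemma Le_pivot G G' : G' \in Le G ->
  exists2 x, pivot_den x (adjmx G) \in unitmx
           & adjmx G' = HA (diag_mx x) (adjmx G).
Proof.
rewrite inE => /connectP[p]; elim/last_ind: p => [|p G1 IHp] in G' *.
  by move=> _ ->; exists 0; rewrite ?HA0 // pivot_den0 unitmx1.
rewrite rcons_path last_rcons => /andP[/IHp/(_ erefl)[x uD eqG]] + ->.
case/existsP=> i /existsP[j /andP[Gij /eqP->]].
have [uDij ->] := elc_HA Gij; move: uDij; rewrite eqG HA_comp_unit // => uDxy.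
by exists (x + pair_row i j) => //; rewrite HA_comp.
Qed.

(** * Counting the class through the fibres *)

(** The zero diagonal comes from [pivot_reachable]: every defined pivot of [adjmx G] is the
    adjacency matrix of a graph. *)
Lemma mem_Delta_e G x :
  (x \in Delta_e G) = (pivot_den x (adjmx G) \in unitmx).
Proof.
rewrite !inE adjmx_adjacency /= -/(pivot_den x (adjmx G)).
apply: andb_idr => /pivot_reachable[G' _ <-].
by case/andP: (adjmx_adjacency G').
Qed.

Lemma mem_Sigma_e G x : (x \in Sigma_e G) =
  (pivot_den x (adjmx G) \in unitmx)
  && (HA (diag_mx x) (adjmx G) == adjmx G).
Proof. by rewrite -mem_Delta_e !inE. Qed.

Lemma adjmx_Le G :
  [set adjmx G' | G' in Le G]
  = [set HA (diag_mx x) (adjmx G) | x in Delta_e G].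
Proof.
apply/setP => M; apply/imsetP/imsetP => [[G' /Le_pivot[x uD ->] ->]|[x]].
  by exists x; rewrite ?mem_Delta_e.
by rewrite mem_Delta_e => /pivot_reachable[G' LeG' <-] ->; exists G'.
Qed.

Lemma pivot_fibre G x y :
  x \in Delta_e G ->
  (y \in Delta_e G)
  && (HA (diag_mx y) (adjmx G) == HA (diag_mx x) (adjmx G))
  = (x + y \in Sigma_e G).
Proof.
rewrite !mem_Delta_e mem_Sigma_e => uDx.
apply/andP/andP => [[uDy /eqP eqH]|[uDxy /eqP eqH]].
  (* Apply the pivot by [y] to the common image: from the [y] side it returns to [G], from the [x]
     side it is the pivot by [x + y]. *)
  have uDxy : pivot_den (x + y) (adjmx G) \in unitmx.
    rewrite -(HA_comp_unit y uDx) -eqH (HA_comp_unit y uDy) F2_addrr.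
    by rewrite pivot_den0 unitmx1.
  have uDyy : pivot_den (y + y) (adjmx G) \in unitmx.
    by rewrite F2_addrr pivot_den0 unitmx1.
  split; [exact: uDxy | apply/eqP].
  by rewrite -(HA_comp uDx uDxy) -eqH (HA_comp uDy uDyy) F2_addrr HA0.
(* Conversely, pivot first by [x + y], which fixes [G], then by [x]. *)
have yE : (x + y) + x = y by rewrite addrAC F2_addrr add0r.
have uDy : pivot_den y (adjmx G) \in unitmx.
  by rewrite -{1}yE -(HA_comp_unit x uDxy) eqH.
split; [exact: uDy | apply/eqP].
by have := @HA_comp (x + y) x (adjmx G) uDxy; rewrite yE eqH => /(_ uDy) ->.
Qed.

(** Over each value of the pivot map, [pivot_fibre] identifies the fibre with a translate of
    [Sigma_e G], so all fibres have the same size. *)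
Lemma card_Delta_e G : #|Delta_e G| = (#|Le G| * #|Sigma_e G|)%N.
Proof.
rewrite -(card_imset (Le G) adjmx_inj) adjmx_Le -sum1_card.
rewrite (partition_big_imset (fun x => HA (diag_mx x) (adjmx G))) /=.
rewrite -sum_nat_const; apply: eq_bigr => _ /imsetP[x Dx ->].
rewrite sum1dep_card -(card_imset (Sigma_e G) (addrI x)).
apply: eq_card => y; rewrite inE pivot_fibre //.
have xK z : x + (x + z) = z by rewrite addrA F2_addrr add0r.
by apply/idP/imsetP => [Sy|[z Sz ->]]; [exists (x + y) | rewrite xK].
Qed.

End Pivot.

Theorem mainTheorem3 (n : nat) (G : sgraph n) :
  [/\ (#|Le G|%:R = #|Delta_e G|%:R / #|Sigma_e G|%:R :> rat),
      #|Delta_e G| =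
        #|[set w : {set 'I_n} | principal_submx (adjmx G) w \in unitmx]|
    & Sigma_e G =
        [set x : 'rV['F_2]_n |
          (adjmx G + 1%:M) *m diag_mx x *m (adjmx G + 1%:M) == 0]].
Proof.
split.
- rewrite card_Delta_e natrM mulfK // Num.Theory.pnatr_eq0 -lt0n.
  (* The zero vector gives the identity pivot, so the rational denominator is nonzero. *)
  apply/card_gt0P; exists 0.
  by rewrite mem_Sigma_e pivot_den0 unitmx1 HA0 eqxx.
- rewrite -(on_card_preimset (onW_bij _ (@support_set_bij n))).
  by apply: eq_card => x; rewrite mem_Delta_e pivot_den_unit !inE.
- by apply/setP => x; rewrite mem_Sigma_e HA_fixP inE.
Qed.
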